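(* Let $X$ be a set endowed with two arbitrary single-valued binary operations $+$ and $\times$ and with two fixed different points $\xi_0,\xi_1\in X$. Let $S$ denote the set $S'(X)$ of all l-prime ideals in $(X,+,\times)$ (respectively, let $S$ denote the set $S'(X)_{pr}$ of all proper l-prime ideals in $(X,+,\times)$), with the two topologies described in the context. Then, in each of the two cases, there exist a distributive lattice $(L,\vee,\wedge)$ with $0$ and $1$ and a function $\varphi:X\to L$ such that: (i) the set $\varphi(X)$ generates $L$; (ii) $\varphi^{-1}(q)\in S$ for every $q\in\mathrm{spec}(L)$; (iii) $\Phi:\mathrm{spec}(L)\to S$, $q\mapsto\varphi^{-1}(q)$, is an $\mathbf{S}$-isomorphism; (iv) if $L'$ is a distributive lattice with $0$ and $1$ and $\theta:X\to L'$ is a function such that (1) $\theta^{-1}(q)\in S$ for every $q\in\mathrm{spec}(L')$, and (2) $\Theta:\mathrm{spec}(L')\to S$, $q\mapsto\theta^{-1}(q)$, is an $\mathbf{S}$-morphism, then there exists a unique lattice homomorphism $l:L\to L'$ with $l\circ\varphi=\theta$; (v) if $L_1$ is a distributive lattice with $0$ and $1$ and $\varphi_1:X\to L_1$ is a function such that (1') $\varphi_1^{-1}(q)\in S$ for every $q\in\mathrm{spec}(L_1)$, and (2') $\Phi_1:\mathrm{spec}(L_1)\to S$, $q\mapsto\varphi_1^{-1}(q)$, is an $\mathbf{S}$-isomorphism, then there exists a unique lattice isomorphism $l:L\to L_1$ with $l\circ\varphi=\varphi_1$; (vi) $\varphi(a+b)=\varphi(a)\vee\varphi(b)$ and $\varphi(a\times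 b)=\varphi(a)\wedge\varphi(b)$ for every $a,b\in X$.
   Context: A subset $p\subseteq X$ is an l-prime ideal in $(X,+,\times)$ if for all $x,y\in X$: (i) $x+y\in p$ iff $x\in p$ and $y\in p$; (ii) $x\times y\in p$ iff $x\in p$ or $y\in p$. It is proper if $\xi_0\in p$ and $\xi_1\notin p$. On a family $S$ of subsets of $X$ (here $S'(X)$ or $S'(X)_{pr}$), $\mathcal{T}^+$ (resp. $\mathcal{T}^-$) is the topology having as subbase the sets $\{p\in S: x\notin p\}$ (resp. $\{p\in S: x\in p\}$), $x\in X$ (the whole set is the empty intersection). With these topologies $S'(X)$ and $S'(X)_{pr}$ are regarded as abstract spectra in the following sense. Compact means that every open cover has a finite subcover. For a set $S$ with two topologies put $\mathcal{L}^+=\{U\in\mathcal{T}^+: S\setminus U\in\mathcal{T}^-\}$ and $\mathcal{L}^-=\{U\in\mathcal{T}^-: S\setminus U\in\mathcal{T}^+\}$. A non-empty bitopological space $(S,\mathcal{T}^+,\mathcal{T}^-)$ is an abstract spectrum if: (SP1) $\mathcal{L}^+$ is a base for $\mathcal{T}^+$ and $\mathcal{L}^-$ is a base for $\mathcal{T}^-$; (SP2) if $F\subseteq S$ and $S\setminus F\in\mathcal{T}^+$ (resp. $S\setminus F\in\mathcal{T}^-$) then $F$ is a compact subset of $(S,\mathcal{T}^-)$ (resp. of $(S,\mathcal{T}^+)$); (SP3) at least one of $(S,\mathcal{T}^+)$, $(S,\mathcal{T}^-)$ is $T_0$. An $\mathbf{S}$-morphism between abstract spectra is a function continuous with respect to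 both the $+$ topologies and the $-$ topologies; an $\mathbf{S}$-isomorphism is a bijection that is an $\mathbf{S}$-morphism together with its inverse. Lattices have $0$ and $1$ (not required to be distinct), lattice homomorphisms preserve $0$ and $1$, and ''generates'' means as a lattice with $0$ and $1$. For a distributive lattice $L$, an ideal is a subset containing $0$, closed under $\vee$ and downward closed; a lattice prime ideal is an ideal $p$ with $1\notin p$ such that $a\wedge b\in p$ implies $a\in p$ or $b\in p$. $\mathrm{spec}(L)$ is the set of all lattice prime ideals of $L$, regarded as an abstract spectrum with $\mathcal{T}^+$ the Stone topology (generated by the sets $\{p: a\notin p\}$, $a\in L$) and $\mathcal{T}^-$ generated by the sets $\{p: a\in p\}$, $a\in L$.
   Formalization: The set of proper l-prime ideals can be empty (e.g. X={ξ0,ξ1} with + constantly ξ1), and spec of the one-element lattice is empty; so the empty bitopological space is also admitted as source or target of S-morphisms, although abstract spectra are defined to be non-empty. *)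

(* Defs.v *)
From HB Require Import structures.
From mathcomp Require Import all_boot all_order.
From mathcomp Require Import all_classical topology.

Set Implicit Arguments.
Unset Strict Implicit.
Unset Printing Implicit Defensive.

Local Open Scope classical_set_scope.

Record bispace := Bispace {
  points :> Type;
  pos_class : Topological points;
  neg_class : Topological points }.

Definition pos (T : bispace) : topologicalType := Topological.Pack (pos_class T).
Definition neg (T : bispace) : topologicalType := Topological.Pack (neg_class T).

Definition Lpos (T : bispace) : set (set T) :=
  [set U | @open (pos T) U /\ @open (neg T) (~` U)].
Definition Lneg (T : bispace) : set (set T) :=
  [set U | @open (neg T) U /\ @open (pos T) (~` U)].

Definition SP1 (T : bispace) : Prop :=
  @basis (pos T) (@Lpos T) /\ @basis (neg T) (@Lneg T).

Definition SP2 (T : bispace) : Prop :=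
  forall F : set T,
    (@open (pos T) (~` F) -> @cover_compact (neg T) F) /\
    (@open (neg T) (~` F) -> @cover_compact (pos T) F).

Definition SP3 (T : bispace) : Prop :=
  kolmogorov_space (pos T) \/ kolmogorov_space (neg T).

Definition abstract_spectrum (T : bispace) : Prop :=
  [/\ [set: T] !=set0, SP1 T, SP2 T & SP3 T].

(* The one-element lattice has no prime ideal, and a set with two operations may
   have no proper l-prime ideal; the empty bispace is therefore admitted as a
   source or target of morphisms. *)
Definition spectral_or_empty (T : bispace) : Prop :=
  [set: T] = set0 \/ abstract_spectrum T.

Definition S_morphism (T U : bispace) (f : T -> U) : Prop :=
  [/\ spectral_or_empty T, spectral_or_empty U,
      continuous (f : pos T -> pos U) & continuous (f : neg T -> neg U)].

Definition S_isomorphism (T U : bispace) (f : T -> U) : Prop :=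
  S_morphism f /\
  exists g : U -> T, [/\ cancel f g, cancel g f & S_morphism g].

Section FamilyTopologies.
Context {X : Type}.

Definition pos_subbase (S : set (set X)) : set (set S) :=
  range (fun x => [set p : S | ~ set_val p x]).
Definition neg_subbase (S : set (set X)) : set (set S) :=
  range (fun x => [set p : S | set_val p x]).

Definition pos_family (S : set (set X)) : Type := S.
Definition neg_family (S : set (set X)) : Type := S.

HB.instance Definition _ (S : set (set X)) := Choice.on (pos_family S).
HB.instance Definition _ (S : set (set X)) :=
  isSubBaseTopological.Build (pos_family S) (@pos_subbase S) id.
HB.instance Definition _ (S : set (set X)) := Choice.on (neg_family S).
HB.instance Definition _ (S : set (set X)) :=
  isSubBaseTopological.Build (neg_family S) (@neg_subbase S) id.

Definition family_bispace (S : set (set X)) : bispace :=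
  @Bispace S (Topological.class (pos_family S)) (Topological.class (neg_family S)).

End FamilyTopologies.

Section LPrime.
Variables (X : Type) (add mul : X -> X -> X).

Definition lprime_ideals : set (set X) :=
  [set p | (forall x y, p (add x y) <-> p x /\ p y) /\
           (forall x y, p (mul x y) <-> p x \/ p y)].

Definition proper_lprime_ideals (xi0 xi1 : X) : set (set X) :=
  [set p | [/\ lprime_ideals p, p xi0 & ~ p xi1]].

End LPrime.

Section Lattices.
Context {d : Order.disp_t} (L : tbDistrLatticeType d).

Definition lattice_ideal (p : set L) : Prop :=
  [/\ p Order.bottom,
      forall a b, p a -> p b -> p (Order.join a b) &
      forall a b, (a <= b)%O -> p b -> p a].

Definition lattice_prime_ideal (p : set L) : Prop :=
  [/\ lattice_ideal p, ~ p Order.top &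
      forall a b, p (Order.meet a b) -> p a \/ p b].

Definition prime_ideals : set (set L) := [set p | lattice_prime_ideal p].

Definition spec : bispace := family_bispace prime_ideals.

Definition bounded_sublattice (A : set L) : Prop :=
  [/\ A Order.bottom, A Order.top,
      forall a b, A a -> A b -> A (Order.join a b) &
      forall a b, A a -> A b -> A (Order.meet a b)].

Definition generates (G : set L) : Prop := smallest bounded_sublattice G = setT.

End Lattices.

(* Order.TBLatticeMorphism only records the preservation of bottom and top, so it
   is not used for the bounded lattice homomorphisms. *)
Definition lattice_hom {d d' : Order.disp_t} {L : tbDistrLatticeType d}
    {L' : tbDistrLatticeType d'} (f : L -> L') : Prop :=
  [/\ f Order.bottom = Order.bottom, f Order.top = Order.top,
      {morph f : a b / Order.join a b} & {morph f : a b / Order.meet a b}].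

Definition lattice_iso {d d' : Order.disp_t} {L : tbDistrLatticeType d}
    {L' : tbDistrLatticeType d'} (f : L -> L') : Prop :=
  lattice_hom f /\ bijective f.

Definition pullback {X : Type} (S : set (set X)) {d : Order.disp_t}
    (L : tbDistrLatticeType d) (f : X -> L)
    (fS : forall q : set L, prime_ideals q -> S (f @^-1` q)) :
    spec L -> family_bispace S :=
  fun q => SigSub (mem_set (fS (set_val q) (set_valP q))).

(* Main.v *)
(** [L] is the ring of subsets of [S] generated by the sets [D x] of those [p]
    that avoid [x], and [phi x = D x]; a point [p] of [S] corresponds to the
    prime ideal of all members of the ring avoiding [p]. Given [theta : X ->
    L'], the preimage in [spec L'] of a member of the ring is, by induction
    on its construction, the set of prime ideals avoiding some element of
    [L'], which is unique because prime ideals separate points; this element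
    is the value of the homomorphism. The family [S] is closed under limits
    of ultrafilters, which gives compactness; compactness identifies the
    ring with the sets that are [T+]-open with [T-]-open complement, whence
    the surjectivity in (v). *)

Require Import Defs.
From HB Require Import structures.
From mathcomp Require Import all_boot all_order.
From mathcomp Require Import finmap all_classical topology.

Set Implicit Arguments.
Unset Strict Implicit.
Unset Printing Implicit Defensive.

Import Order.Theory.
Local Open Scope classical_set_scope.

(** * The bounded sublattice generated by a set, as a distributive lattice *)

Section SublatticeGeneration.
Context {d : Order.disp_t} {L : tbDistrLatticeType d}.
Implicit Types G A : set L.

Lemma smallest_bounded_sublattice G :
  bounded_sublattice (smallest (@bounded_sublattice d L) G).
Proof.
split=> [A [[]] // | A [[]] // | a b Ga Gb A AG | a b Ga Gb A AG].
- by case: (AG) => -[_ _ + _] _; apply; [apply: Ga | apply: Gb].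
- by case: (AG) => -[_ _ _ +] _; apply; [apply: Ga | apply: Gb].
Qed.

(** A separate name for the subtype, so that the sublattice instances below attach to it. *)
Definition gen_lattice G : Type := smallest (@bounded_sublattice d L) G.

Section Instances.
Variable G : set L.
Let gen := smallest (@bounded_sublattice d L) G.

HB.instance Definition _ := SubChoice.copy (gen_lattice G) (set_type gen).

Let genI : {in gen &, forall a b, Order.meet a b \in gen}.
Proof.
move=> a b /set_mem Ga /set_mem Gb; apply: mem_set.
by case: (smallest_bounded_sublattice G) => _ _ _; apply.
Qed.

Let genU : {in gen &, forall a b, Order.join a b \in gen}.
Proof.
move=> a b /set_mem Ga /set_mem Gb; apply: mem_set.
by case: (smallest_bounded_sublattice G) => _ _ + _; apply.
Qed.

Let gen0 : Order.bottom \in gen.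
Proof. by apply: mem_set; case: (smallest_bounded_sublattice G). Qed.

Let gen1 : Order.top \in gen.
Proof. by apply: mem_set; case: (smallest_bounded_sublattice G). Qed.

HB.instance Definition _ :=
  Order.SubChoice_isTBSubLattice.Build d L (fun x => x \in gen) d
    (gen_lattice G) genI genU gen0 gen1.

Lemma gen_latticeI :
  {morph (val : gen_lattice G -> L) : a b / Order.meet a b}.
Proof. exact: Order.valI_subproof. Qed.

Lemma gen_latticeU :
  {morph (val : gen_lattice G -> L) : a b / Order.join a b}.
Proof. exact: Order.valU_subproof. Qed.

Lemma gen_lattice0 : val (Order.bottom : gen_lattice G) = Order.bottom.
Proof. exact: Order.val0_subproof. Qed.

Lemma gen_lattice1 : val (Order.top : gen_lattice G) = Order.top.
Proof. exact: Order.val1_subproof. Qed.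

Let genIUl : left_distributive (@Order.meet d (gen_lattice G)) Order.join.
Proof.
move=> a b c; apply: val_inj.
by rewrite gen_latticeU !gen_latticeI gen_latticeU meetUl.
Qed.

HB.instance Definition _ :=
  Order.Lattice_Meet_isDistrLattice.Build d (gen_lattice G) genIUl.
End Instances.
End SublatticeGeneration.

(** * The two topologies of a family of sets and their common ring of subsets *)

Section FamilySpectrum.
Context {X : Type}.
Implicit Types S : set (set X).

Definition subbase_ring S : set (set S) :=
  smallest (@bounded_sublattice _ (set S)) (@pos_subbase X S).

Lemma subbase_ring_sublattice S :
  bounded_sublattice (@subbase_ring S : set (set S)).
Proof. exact: smallest_bounded_sublattice. Qed.

Lemma subbase_ring_gen S (x : X) : subbase_ring [set p : S | ~ set_val p x].
Proof. by apply: sub_gen_smallest; exists x. Qed.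

Lemma subbase_ring_ind S (P : set S -> Prop) :
  P set0 -> P setT ->
  (forall U V, P U -> P V -> P (U `|` V)) ->
  (forall U V, P U -> P V -> P (U `&` V)) ->
  (forall x, P [set p : S | ~ set_val p x]) ->
  forall U, subbase_ring U -> P U.
Proof.
move=> P0 P1 PU PI Px U; apply: smallest_sub U; first by split.
by move=> _ [x _ <-].
Qed.

Lemma open_pos_gen S (x : X) :
  @open (pos (family_bispace S)) [set p : S | ~ set_val p x].
Proof.
exists [set [set p : S | ~ set_val p x]]; last by rewrite bigcup_set1.
by move=> _ ->; apply: (@finI_from1 _ _ _ id); exists x.
Qed.

Lemma open_neg_gen S (x : X) :
  @open (neg (family_bispace S)) [set p : S | set_val p x].
Proof.
exists [set [set p : S | set_val p x]]; last by rewrite bigcup_set1.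
by move=> _ ->; apply: (@finI_from1 _ _ _ id); exists x.
Qed.

Lemma finI_from_sub (T : Type) (D : set (set T)) (P : set (set T)) :
  P setT -> (forall U V, P U -> P V -> P (U `&` V)) -> D `<=` P ->
  finI_from D id `<=` P.
Proof.
move=> P1 PI DP _ [F FD <-].
rewrite bigcap_fset big_seq; elim/big_ind: _ => // U /FD /set_mem.
exact: DP.
Qed.

(** A basic open set is a finite intersection of generators of the ring, hence itself a member of
    the ring. *)
Lemma open_pos_ring S (W : set S) (p : S) :
  @open (pos (family_bispace S)) W -> W p ->
  exists U, [/\ subbase_ring U, U p & U `<=` W].
Proof.
case: (subbase_ring_sublattice S) => _ ringT _ ringI.
case=> D sD <- [U DU Up]; exists U; split=> //; last by move=> q Uq; exists U.
apply: finI_from_sub (sD _ DU) => // _ [x _ <-].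
exact: subbase_ring_gen.
Qed.

(** Dually, a finite intersection of complements of generators is the complement of a finite union
    of generators. *)
Lemma open_neg_ring S (W : set S) (p : S) :
  @open (neg (family_bispace S)) W -> W p ->
  exists U, [/\ subbase_ring U, ~ U p & ~` U `<=` W].
Proof.
case: (subbase_ring_sublattice S) => ring0 _ ringU _.
case=> D sD <- [U DU Up]; exists (~` U); split.
- apply: (@finI_from_sub _ _ [set U | subbase_ring (~` U)]) (sD _ DU) => /=.
  + by rewrite setCT.
  + by move=> V V' RV RV'; rewrite setCI; apply: ringU.
  + by move=> _ [x _ <-]; apply: subbase_ring_gen.
- by move=> /(_ Up).
- by move=> q; rewrite setCK => Uq; exists U.
Qed.

Lemma subbase_ring_open S (U : set S) : subbase_ring U ->
  @open (pos (family_bispace S)) U /\ @open (neg (family_bispace S)) (~` U).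
Proof.
elim/subbase_ring_ind => [| |V W [oV cV] [oW cW]|V W [oV cV] [oW cW]|x].
- by rewrite setC0; split; [apply: open0 | apply: openT].
- by rewrite setCT; split; [apply: openT | apply: open0].
- by rewrite setCU; split; [apply: openU | apply: openI].
- by rewrite setCI; split; [apply: openI | apply: openU].
split; first exact: open_pos_gen.
rewrite (_ : ~` _ = [set p : S | set_val p x]); first exact: open_neg_gen.
by apply/seteqP; split=> p /=; [apply: contrapT | move=> ? /(_ _)].
Qed.

Lemma family_SP1 S : SP1 (family_bispace S).
Proof.
split; split=> [U [] // | p W].
- rewrite nbhsE => -[V [oV Vp] VW].
  have [U [RU Up UV]] := open_pos_ring oV Vp.
  exists U; last exact: subset_trans VW.
  by split=> //; apply: subbase_ring_open.
- rewrite nbhsE => -[V [oV Vp] VW].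
  have [U [RU Up UV]] := open_neg_ring oV Vp.
  exists (~` U); last exact: subset_trans VW.
  by split=> //; split; rewrite ?setCK; case: (subbase_ring_open RU).
Qed.

(** Two distinct members of [S] differ at some [x]; the [pos]-open set of members avoiding [x]
    contains exactly one of them. *)
Lemma family_SP3 S : SP3 (family_bispace S).
Proof.
left=> p q /eqP pq.
have [x px] : exists x, ~ (set_val p x <-> set_val q x).
  apply: contrapT => /forallNP pq'; apply: pq; apply: val_inj.
  by apply/funext => x; apply: propext; apply: contrapT; apply: pq'.
exists [set r : S | ~ set_val r x].
have nx r : ~ set_val r x -> [set r : S | ~ set_val r x] \in
    (@nbhs _ (pos (family_bispace S)) r : set (set S)).
  by move=> ?; apply/mem_set/open_nbhs_nbhs; split=> //; apply: open_pos_gen.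
have [pX | pX] := pselect (set_val p x).
- right; split; [apply: nx | by apply/mem_set => /=; apply].
  by move=> qx; apply: px.
- by left; split; [exact: nx | apply/mem_set => /= qx; apply: px].
Qed.


(** * Ultrafilters and compactness *)

Lemma filter_meet (T : Type) (F : set_system T) {FF : ProperFilter F} (A B : set T) :
  F A -> F B -> exists x, A x /\ B x.
Proof. by move=> FA FB; apply: (@filter_ex _ F); apply: filterI. Qed.

(** Without a finite subcover, the sets [A] minus a finite union generate a proper filter. An
    ultrafilter refining it has a limit in [A], which lies in some [f i]; the ultrafilter then
    contains both [f i] and [A] minus [f i]. *)
Lemma ultra_cover_compact (T : topologicalType) (A : set T) :
  (forall F : set_system T, UltraFilter F -> F A -> exists2 p, A p & F --> p) ->
  cover_compact A.
Proof.
move=> Aultra I D f fop Acov; apply: contrapT => nocov.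
pose sub : set {fset I} := fun D' => {subset D' <= D}.
pose B (D' : {fset I}) := A `\` cover [set` D'] f.
have sub0 : sub fset0 by [].
have [F [FU BF]] : exists F, UltraFilter F /\ filter_from sub B `<=` F.
  apply: ultraFilterLemma; apply: filter_from_proper.
    apply: filter_from_filter; first by exists fset0.
    move=> D1 D2 sD1 sD2; exists (D1 `|` D2)%fset.
      by move=> i /fsetUP [/sD1|/sD2].
    move=> p [Ap np]; split; split=> // -[i /= iD fip]; apply: np;
      exists i => //=;
      by rewrite inE iD ?orbT.
  move=> D' sD'; apply: contrapT => /set0P/negP/negPn/eqP B0.
  by apply: nocov; exists D' => //; rewrite -setD_eq0.
have FA : F A.
  apply: filterS (BF (B fset0) _); first by move=> p [].
  by exists fset0.
have [p Ap Fp] := Aultra F FU FA.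
have [i Di fip] := Acov _ Ap.
have Ffi : F (f i) by apply: Fp; apply: open_nbhs_nbhs; split=> //; apply: fop.
have FB : F (B [fset i]%fset).
  apply: BF; exists [fset i]%fset => //.
  by move=> j; rewrite inE => /eqP ->; apply: mem_set.
have [q [fiq [_ nq]]] := filter_meet Ffi FB.
by apply: nq; exists i => //=; rewrite inE.
Qed.

(* Equivalently, [S] is closed in the product topology of [2 ^ X]. *)
Definition ultra_closed S :=
  forall F : set_system S, UltraFilter F ->
  S [set x | F [set p : S | set_val p x]].

Lemma ultra_notE (T : Type) (F : set_system T) (A : set T) :
  UltraFilter F -> F (~` A) <-> ~ F A.
Proof.
move=> FU; split=> [FnA FA | nFA]; last by case: (in_ultra_setVsetC A FU).
by have [x []] := filter_meet FA FnA.
Qed.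

Lemma ultra_orE (T : Type) (F : set_system T) (A B : set T) :
  UltraFilter F -> F (A `|` B) <-> F A \/ F B.
Proof.
move=> FU; split; last by case; apply: filterS => x; [left | right].
move=> FAB; apply: contrapT => /not_orP [nFA nFB].
have FA := (ultra_notE A FU).2 nFA; have FB := (ultra_notE B FU).2 nFB.
have [x [[Ax | Bx] [nAx nBx]]] :=
  filter_meet FAB (filterI FA FB); [exact: nAx | exact: nBx].
Qed.

Lemma ultra_andE (T : Type) (F : set_system T) (A B : set T) :
  Filter F -> F (A `&` B) <-> F A /\ F B.
Proof.
move=> FU; split; last by case; apply: filterI.
by move=> FAB; split; apply: filterS FAB => x [].
Qed.

(** The point is the set of all [x] that belong to [F]-almost every member of [S]. Agreement on
    generators passes to the ring because an ultrafilter commutes with unions and intersections. *)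
Lemma ultra_limit S (F : set_system S) : ultra_closed S -> UltraFilter F ->
  exists p : S, forall U, subbase_ring U -> U p <-> F U.
Proof.
move=> SF FU; exists (SigSub (mem_set (SF F FU))).
apply: subbase_ring_ind => [| |V W IV IW|V W IV IW|x].
- by split=> // F0; have /filter_ex [] := F0.
- by split=> // _; apply: filterT.
- by rewrite ultra_orE -IV -IW.
- by rewrite ultra_andE -IV -IW.
- exact: iff_sym (ultra_notE [set p : S | set_val p x] FU).
Qed.

(** The point given by [ultra_limit] is a limit of [F] in both topologies, since ring members and
    their complements are bases. If it lay outside [A], a basic neighbourhood disjoint from [A]
    would belong to [F] together with [A]. *)
Lemma family_SP2 S : ultra_closed S -> SP2 (family_bispace S).
Proof.
move=> SF A; split=> oA; apply: ultra_cover_compact => F FU FA.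
  have [p Fp] := ultra_limit SF FU; exists p.
    apply: contrapT => nAp.
    have [U [RU Up UA]] := open_pos_ring oA nAp.
    have FU' := (Fp U RU).1 Up.
    by have [q [/UA]] := filter_meet FU' FA.
  move=> W; rewrite nbhsE => -[V [oV Vp] VW].
  have [U [RU Up UV]] := open_neg_ring oV Vp.
  apply: filterS VW _; apply: filterS UV _.
  by apply/(ultra_notE U FU) => /(Fp U RU).
have [p Fp] := ultra_limit SF FU; exists p.
  apply: contrapT => nAp.
  have [U [RU Up UA]] := open_neg_ring oA nAp.
  have FU' : F (~` U) by apply/(ultra_notE U FU) => /(Fp U RU).
  by have [q [/UA]] := filter_meet FU' FA.
move=> W; rewrite nbhsE => -[V [oV Vp] VW].
have [U [RU Up UV]] := open_pos_ring oV Vp.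
by apply: filterS VW _; apply: filterS UV _; apply/(Fp U RU).
Qed.

Lemma family_spectral S : ultra_closed S -> spectral_or_empty (family_bispace S).
Proof.
move=> SF; have [S0 | /set0P S0] := eqVneq [set: family_bispace S] set0.
  by left.
by right; split=> //; [apply: family_SP1 | apply: family_SP2 | apply: family_SP3].
Qed.

(** By (SP2) such a [W] is [pos]-compact. Being [pos]-open, it is covered by the ring members inside
    it, so it is a finite union of them. *)
Lemma Lpos_subbase_ring S (W : set S) : ultra_closed S ->
  @Lpos (family_bispace S) W -> subbase_ring W.
Proof.
case: (subbase_ring_sublattice S) => ring0 _ ringU _ SF [oW cW].
have Wcompact : @cover_compact (pos (family_bispace S)) W.
  by apply: (family_SP2 SF W).2.
have [||D sD WD] := Wcompact (set S) [set U | subbase_ring U /\ U `<=` W] id.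
- by move=> U [/subbase_ring_open []].
- by move=> p Wp; have [U [RU Up UW]] := open_pos_ring oW Wp; exists U.
rewrite (_ : W = cover [set` D] id).
  rewrite /cover bigcup_fset big_seq; elim/big_ind: _ => // U /sD /set_mem.
  by case.
apply/seteqP; split=> // p [U /sD /set_mem [_ UW]]; exact: UW.
Qed.

(** * Continuity tested on the subbases *)

Lemma continuous_pos S (T : topologicalType) (f : T -> S) :
  (forall x, open (f @^-1` [set p : S | ~ set_val p x])) ->
  continuous (f : T -> pos (family_bispace S)).
Proof.
move=> fop; apply/continuousP => W oW.
have fring : forall U, subbase_ring U -> open (f @^-1` U).
  by apply: subbase_ring_ind => [| |V V' oV oV'|V V' oV oV'|x];
    [apply: open0 | apply: openT | apply: openU | apply: openI | apply: fop].
rewrite openE => t Wt; have [U [RU Ut UW]] := open_pos_ring oW Wt.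
apply: filterS (open_nbhs_nbhs (conj (fring U RU) Ut)).
by move=> s /UW.
Qed.

Lemma continuous_neg S (T : topologicalType) (f : T -> S) :
  (forall x, open (f @^-1` [set p : S | set_val p x])) ->
  continuous (f : T -> neg (family_bispace S)).
Proof.
move=> fop; apply/continuousP => W oW.
have fring : forall U, subbase_ring U -> open (f @^-1` (~` U)).
  apply: subbase_ring_ind => [| |V V' oV oV'|V V' oV oV'|x].
  - by rewrite setC0; apply: openT.
  - by rewrite setCT; apply: open0.
  - by rewrite setCU; apply: openI.
  - by rewrite setCI; apply: openU.
  - rewrite (_ : ~` _ = [set p : S | set_val p x]); first exact: fop.
    by apply/seteqP; split=> p /=; [apply: contrapT | move=> ? /(_ _)].
rewrite openE => t Wt; have [U [RU Ut UW]] := open_neg_ring oW Wt.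
apply: filterS (open_nbhs_nbhs (conj (fring U RU) Ut)).
by move=> s /UW.
Qed.

End FamilySpectrum.

(** * Prime ideals of a distributive lattice *)

Section PrimeIdeals.
Context {d : Order.disp_t} {L : tbDistrLatticeType d}.
Implicit Types a b : L.

Lemma prime_idealU (q : set L) a b :
  prime_ideals q -> q (Order.join a b) <-> q a /\ q b.
Proof.
case=> -[_ qU qle] _ _; split=> [qab | []]; last exact: qU.
by split; apply: qle qab; [apply: leUl | apply: leUr].
Qed.

Lemma prime_idealI (q : set L) a b :
  prime_ideals q -> q (Order.meet a b) <-> q a \/ q b.
Proof.
case=> -[_ _ qle] _ qI; split=> [|[]]; first exact: qI.
  by apply: qle; apply: leIl.
by apply: qle; apply: leIr.
Qed.

Lemma prime_ideal0 (q : set L) : prime_ideals q -> q Order.bottom.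
Proof. by case=> -[]. Qed.

Lemma prime_ideal1 (q : set L) : prime_ideals q -> ~ q Order.top.
Proof. by case. Qed.

(** An ideal maximal among those containing [b] and avoiding [a] is prime: if [x] and [y] lie
    outside it, enlarging it by either one captures [a], and by distributivity so does enlarging it
    by their meet. *)
Lemma prime_ideal_separation a b :
  ~~ (a <= b)%O -> exists q : set L, [/\ prime_ideals q, q b & ~ q a].
Proof.
move=> nab.
(* Joining with [b] in the closure condition makes the empty set admissible, as
   required for the empty chain, while every nonempty member contains [b]. *)
pose P (A : set L) := ~ A a /\
  forall x y z, A x -> A y -> (z <= Order.join (Order.join x y) b)%O -> A z.
have [F FP Ftot | M [[nMa MU] Mmax]] := @Zorn_bigcup L P.
  split=> [[A FA Aa] | x y z [A FA Ax] [B FB By] zle].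
    by case: (FP _ FA).
  have [AB | BA] := Ftot _ _ FA FB.
    by exists B => //; apply: (FP _ FB).2 zle => //; apply: AB.
  by exists A => //; apply: (FP _ FA).2 zle => //; apply: BA.
(* An empty [M] would be strictly contained in the principal ideal of [b], which satisfies [P]
   because [a] is not below [b]. *)
have [m0 Mm0] : M !=set0.
  apply/set0P/negP => /eqP M0.
  apply: (Mmax [set z | (z <= b)%O]).
    by rewrite M0; split=> [z // | /(_ b (lexx b))].
  split=> [/= ab | x y z /= xb yb]; first by rewrite ab in nab.
  by move=> /le_trans; apply; rewrite !leUx xb yb lexx.
have Mb : M b by apply: (MU _ _ _ Mm0 Mm0); apply: leUr.
have Mle x y : (x <= y)%O -> M y -> M x.
  by move=> xy My; apply: (MU _ _ _ My My); rewrite joinxx lexUl.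
have MUb x y : M x -> M y -> M (Order.join x y).
  by move=> Mx My; apply: MU Mx My _; apply: leUl.
(* Otherwise the ideal generated by [M] and [x] would satisfy [P] and strictly contain [M]. *)
have Mext x : ~ M x -> exists2 m, M m & (a <= Order.join m x)%O.
  move=> nMx; apply: contrapT => noext.
  apply: (Mmax [set z | exists2 m, M m & (z <= Order.join m x)%O]).
    split=> [z Mz | sM]; first by exists z => //; apply: leUl.
    by apply: nMx; apply: sM; exists m0 => //; apply: leUr.
  split=> // y z w [m1 Mm1 ym1] [m2 Mm2 zm2] wle.
  (* The summand [b] absorbs the extra [b] in the closure condition of [P]. *)
  exists (Order.join (Order.join m1 m2) b); first exact: MUb (MUb _ _ Mm1 Mm2) Mb.
  apply: le_trans wle _; rewrite !leUx -andbA; apply/and3P; split.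
  - by apply: le_trans ym1 _; rewrite leUx leUr -!joinA leUl.
  - by apply: le_trans zm2 _; rewrite leUx leUr (joinC m1) -!joinA leUl.
  - by rewrite -joinA joinCA leUl.
exists M; split=> //; split=> //.
- by split=> //; apply: Mle Mb; apply: le0x.
- by apply: contra_not nMa; apply: Mle; apply: lex1.
move=> x y Mxy; apply: contrapT => /not_orP [/Mext [m1 Mm1 am1] /Mext [m2 Mm2 am2]].
(* With the common bound [m1] join [m2], distributivity combines the two bounds on [a] into one
   involving only the meet of [x] and [y]. *)
apply: nMa; apply: (Mle _ (Order.join (Order.join m1 m2) (Order.meet x y))).
  rewrite joinIr lexI; apply/andP; split.
    by apply: le_trans am1 _; rewrite leUx leUr -!joinA leUl.
  by apply: le_trans am2 _; rewrite leUx leUr (joinC m1) -!joinA leUl.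
by apply: (MUb) => //; apply: (MUb).
Qed.

Lemma prime_ideal_ext a b :
  (forall q : spec L, set_val q a <-> set_val q b) -> a = b.
Proof.
have sub x y : (forall q : spec L, set_val q y -> set_val q x) -> (x <= y)%O.
  move=> xy; apply: contrapT => /negP /prime_ideal_separation [q [pq qy]]; apply.
  exact: (xy (SigSub (mem_set pq))).
by move=> ab; apply: le_anti; rewrite !sub // => q /ab.
Qed.

(** Each defining condition involves finitely many elements and passes to the limit. Primality is
    the disjunctive one, where the ultrafilter must choose a side. *)
Lemma prime_ideals_ultra_closed : ultra_closed (@prime_ideals d L).
Proof.
move=> F FU; split; first split=> /=.
- by apply: filterS filterT => q _; apply: prime_ideal0 (set_valP q).
- move=> a b Fa Fb; have /(filterI Fa) := Fb; apply: filterS => q.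
  by move/(prime_idealU a b (set_valP q)).
- move=> a b ab; apply: filterS => q.
  by case: (set_valP q) => -[_ _ qle] _ _; apply: qle.
- move=> F1; have [q] := filter_ex F1.
  exact: prime_ideal1 (set_valP q).
- move=> a b Fab; apply/(ultra_orE _ _ FU); apply: filterS Fab => q.
  by move/(prime_idealI a b (set_valP q)).
Qed.

Lemma spec_spectral : spectral_or_empty (spec L).
Proof. exact: family_spectral prime_ideals_ultra_closed. Qed.

End PrimeIdeals.

(** The equalizer of two homomorphisms is a bounded sublattice. *)
Lemma lattice_hom_ext (d d' : Order.disp_t) (L : tbDistrLatticeType d)
    (L' : tbDistrLatticeType d') (G : set L) (f g : L -> L') :
  generates G -> lattice_hom f -> lattice_hom g -> {in G, f =1 g} -> f = g.
Proof.
move=> genG [f0 f1 fU fI] [g0 g1 gU gI] fg; apply/funext => a.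
have : [set: L] a by [].
rewrite -genG; apply: (@smallest_sub _ _ _ [set a | f a = g a]) => /=.
  split=> /= [||x y xE yE|x y xE yE].
  - by rewrite f0 g0.
  - by rewrite f1 g1.
  - by rewrite fU gU xE yE.
  - by rewrite fI gI xE yE.
by move=> x Gx; apply: fg; apply: mem_set.
Qed.

(** * Sets of points represented by lattice elements *)

Section Pullback.
Context {X : Type} (S : set (set X)) {d : Order.disp_t}.
Context {L : tbDistrLatticeType d} (f : X -> L).
Hypothesis fS : forall q : set L, prime_ideals q -> S (f @^-1` q).

Lemma pullback_S_morphism : ultra_closed S -> S_morphism (pullback fS).
Proof.
move=> SF; split; [exact: spec_spectral | exact: family_spectral | |].
  by apply: continuous_pos => x; apply: (open_pos_gen _ (f x)).
by apply: continuous_neg => x; apply: (open_neg_gen _ (f x)).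
Qed.

(** The preimage of [U] in [spec L] is the basic Stone-open set of [a]. *)
Definition represents (U : set S) (a : L) :=
  forall q : spec L, U (pullback fS q) <-> ~ set_val q a.

Lemma represents_inj (U : set S) a b : represents U a -> represents U b -> a = b.
Proof.
move=> Ua Ub; apply: prime_ideal_ext => q.
have := Ua q; have := Ub q.
have [] := pselect (set_val q a); have [] := pselect (set_val q b); tauto.
Qed.

Lemma represents0 : represents set0 Order.bottom.
Proof. by move=> q; split=> // /(_ (prime_ideal0 (set_valP q))). Qed.

Lemma represents1 : represents setT Order.top.
Proof. by move=> q; split=> // _; apply: prime_ideal1 (set_valP q). Qed.

Lemma representsU U V a b : represents U a -> represents V b ->
  represents (U `|` V) (Order.join a b).
Proof.
move=> Ua Vb q.
apply: iff_trans (not_iff_compat (iff_sym (prime_idealU a b (set_valP q)))).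
by rewrite not_andE; split=> -[/(Ua q) | /(Vb q)]; by [left | right].
Qed.

Lemma representsI U V a b : represents U a -> represents V b ->
  represents (U `&` V) (Order.meet a b).
Proof.
move=> Ua Vb q.
apply: iff_trans (not_iff_compat (iff_sym (prime_idealI a b (set_valP q)))).
by rewrite not_orE; split=> -[/(Ua q) + /(Vb q)]; split.
Qed.

Lemma represents_gen x : represents [set p : S | ~ set_val p x] (f x).
Proof. by []. Qed.

Lemma represents_ring U : subbase_ring U -> exists a, represents U a.
Proof.
move: U; apply: subbase_ring_ind => [| |V W [a Va] [b Wb]|V W [a Va] [b Wb]|x].
- by exists Order.bottom; apply: represents0.
- by exists Order.top; apply: represents1.
- by exists (Order.join a b); apply: representsU.
- by exists (Order.meet a b); apply: representsI.
- by exists (f x).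
Qed.

End Pullback.

(** A representing element is chosen for every ring member. Uniqueness of representatives makes the
    choice a homomorphism, since unions and intersections are represented by joins and meets. *)
Lemma pullback_factorization (X : Type) (S : set (set X)) (d : Order.disp_t)
    (L : tbDistrLatticeType d) (f : X -> L)
    (fS : forall q : set L, prime_ideals q -> S (f @^-1` q)) :
  exists l : gen_lattice (@pos_subbase X S) -> L,
    lattice_hom l /\ forall U, represents fS (val U) (l U).
Proof.
have [l lP] := choice (fun U : gen_lattice (@pos_subbase X S) =>
  represents_ring fS (set_valP U)).
exists l; split=> //; split.
- by apply: represents_inj (lP _) _; rewrite gen_lattice0; apply: represents0.
- by apply: represents_inj (lP _) _; rewrite gen_lattice1; apply: represents1.
- by move=> U V; apply: represents_inj (lP _) _; rewrite gen_latticeU; apply: representsU.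
- by move=> U V; apply: represents_inj (lP _) _; rewrite gen_latticeI; apply: representsI.
Qed.

(** * The ring of sets and its spectrum *)

Section RingOfSets.
Context {X : Type} (S : set (set X)).
Local Notation L := (gen_lattice (@pos_subbase X S)).

Definition avoiding (x : X) : L := SigSub (mem_set (@subbase_ring_gen X S x)).

Lemma generates_avoiding : generates (range avoiding).
Proof.
case: (smallest_bounded_sublattice (range avoiding)) => g0 g1 gU gI.
apply/seteqP; split=> // U _.
(* Ring induction runs over subsets of [S], so the claim is phrased through a lift [V] to the
   subtype. *)
suff [V VG /val_inj <-] : exists2 V : L,
  smallest (@bounded_sublattice _ L) (range avoiding) V & val V = val U by [].
move: (val U) (set_valP U) => /=.
apply: subbase_ring_ind => [| |V W [V' gV <-] [W' gW <-]|V W [V' gV <-] [W' gW <-]|x].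
- by exists Order.bottom.
- by exists Order.top.
- by exists (Order.join V' W'); [apply: gU | rewrite gen_latticeU].
- by exists (Order.meet V' W'); [apply: gI | rewrite gen_latticeI].
- by exists (avoiding x) => //; apply: sub_gen_smallest; exists x.
Qed.

Definition ideal_at (p : S) : set L := [set U | ~ val U p].

Lemma ideal_at_prime (p : S) : prime_ideals (ideal_at p).
Proof.
split; first split; rewrite /ideal_at /=.
- by [].
- by move=> U V nU nV [].
- by move=> U V /meet_idPl <-; apply: contra_not => -[].
- by apply.
- by move=> U V /not_andP.
Qed.

Definition point_of (p : S) : spec L := SigSub (mem_set (ideal_at_prime p)).

Hypothesis avoidingS : forall q : set L, prime_ideals q -> S (avoiding @^-1` q).

Lemma point_ofK : cancel point_of (pullback avoidingS).
Proof.
move=> p; apply: val_inj; apply/funext => x /=; apply: propext.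
by split=> [/contrapT | px /(_ px)].
Qed.

(** The homomorphism induced by [avoiding] itself fixes the generators, hence is the identity. So
    every ring member represents itself, which says that [q] consists of the members missing its
    pullback. *)
Lemma pullback_avoidingK : cancel (pullback avoidingS) point_of.
Proof.
move=> q; apply: val_inj; apply/funext => U /=; apply: propext.
suff: represents avoidingS (val U) U.
  by move=> /(_ q) UE; split=> [nU | qU /UE //]; apply: contrapT => /UE.
have [l [lhom lP]] := pullback_factorization avoidingS.
suff lE : l = id by have := lP U; rewrite lE.
apply: (lattice_hom_ext generates_avoiding) => // _ /set_mem [x _ <-].
by apply: represents_inj (lP _) _; apply: represents_gen.
Qed.

Lemma pullback_avoiding_S_isomorphism :
  ultra_closed S -> S_isomorphism (pullback avoidingS).
Proof.
move=> SF; split; first exact: pullback_S_morphism.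
exists point_of; split.
- exact: pullback_avoidingK.
- exact: point_ofK.
split; [exact: family_spectral | exact: spec_spectral | |].
  apply: continuous_pos => U.
  (* Under [point_of] the subbasic sets at [U] pull back to [U] and, below, to its complement. *)
  rewrite (_ : _ @^-1` _ = val U); first by case: (subbase_ring_open (set_valP U)).
  by apply/seteqP; split=> p /=; [apply: contrapT | move=> ? /(_ _)].
apply: continuous_neg => U.
rewrite (_ : _ @^-1` _ = ~` val U) //; first by case: (subbase_ring_open (set_valP U)).
Qed.

End RingOfSets.

(** The inverse sends [a] to the preimage under [g] of its Stone-open set. Continuity of [g] in both
    topologies puts this preimage in [Lpos], hence in the ring. *)
Lemma factorization_bijective (X : Type) (S : set (set X)) (d : Order.disp_t)
    (L : tbDistrLatticeType d) (f : X -> L)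
    (fS : forall q : set L, prime_ideals q -> S (f @^-1` q))
    (l : gen_lattice (@pos_subbase X S) -> L) :
  ultra_closed S -> S_isomorphism (pullback fS) ->
  (forall U, represents fS (val U) (l U)) -> bijective l.
Proof.
move=> SF [_ [g [gK fK [_ _ gpos gneg]]]] lP.
have rep_preim a : represents fS (g @^-1` [set q : spec L | ~ set_val q a]) a.
  by move=> q; rewrite /= gK.
have preim_ring a : subbase_ring (g @^-1` [set q : spec L | ~ set_val q a]).
  apply: Lpos_subbase_ring => //; split.
    by move/continuousP: gpos => /(_ _ (open_pos_gen _ a)).
  move/continuousP: gneg => /(_ _ (open_neg_gen _ a)).
  rewrite (_ : ~` _ = g @^-1` [set q : spec L | set_val q a]) //.
  by apply/seteqP; split=> p /=; [apply: contrapT | move=> ? /(_ _)].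
exists (fun a => SigSub (mem_set (preim_ring a))) => [U | a].
  apply: val_inj; apply/funext => p; apply: propext; apply: iff_sym.
  by have := lP U (g p); rewrite fK.
by apply: represents_inj (lP _) _; apply: rep_preim.
Qed.

(** * Ultrafilter limits of l-prime ideals, and the universal lattice *)

Lemma lprime_ideals_ultra_closed (X : Type) (add mul : X -> X -> X)
    (S : set (set X)) (F : set_system S) :
  S `<=` lprime_ideals add mul -> UltraFilter F ->
  lprime_ideals add mul [set x | F [set p : S | set_val p x]].
Proof.
move=> Slp FU; split=> x y /=.
  (* The l-prime condition holds at each point of [S], so both sides test [F] on the same set. *)
  rewrite -ultra_andE; set A := (X in F X <-> _); set B := (X in _ <-> F X).
  rewrite (_ : A = B) //; apply/seteqP.
  by split=> p; have [pA _] := Slp _ (set_valP p); move/(pA x y).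
rewrite -ultra_orE; set A := (X in F X <-> _); set B := (X in _ <-> F X).
rewrite (_ : A = B) //; apply/seteqP.
by split=> p; have [_ pM] := Slp _ (set_valP p); move/(pM x y).
Qed.

Lemma proper_lprime_ideals_ultra_closed (X : Type) (add mul : X -> X -> X)
    (xi0 xi1 : X) : ultra_closed (proper_lprime_ideals add mul xi0 xi1).
Proof.
move=> F FU; split=> /=.
- by apply: lprime_ideals_ultra_closed => p [].
- by apply: filterS filterT => p _; case: (set_valP p).
- move=> F1; have [p] := filter_ex F1.
  by case: (set_valP p).
Qed.

Theorem corollary2p4p3 (X : Type) (add mul : X -> X -> X) (xi0 xi1 : X)
    (hxi : xi0 <> xi1) (S : set (set X))
    (hS : S = lprime_ideals add mul \/
          S = proper_lprime_ideals add mul xi0 xi1) :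
  exists (d : Order.disp_t) (L : tbDistrLatticeType d) (phi : X -> L),
    generates (range phi) /\
    (exists phiS : forall q : set L, prime_ideals q -> S (phi @^-1` q),
       S_isomorphism (pullback phiS)) /\
    (forall (d' : Order.disp_t) (L' : tbDistrLatticeType d') (theta : X -> L')
        (thetaS : forall q : set L', prime_ideals q -> S (theta @^-1` q)),
       S_morphism (pullback thetaS) ->
       exists! l : L -> L', lattice_hom l /\ l \o phi = theta) /\
    (forall (d1 : Order.disp_t) (L1 : tbDistrLatticeType d1) (phi1 : X -> L1)
        (phi1S : forall q : set L1, prime_ideals q -> S (phi1 @^-1` q)),
       S_isomorphism (pullback phi1S) ->
       exists! l : L -> L1, lattice_iso l /\ l \o phi = phi1) /\
    (forall a b : X, phi (add a b) = Order.join (phi a) (phi b) /\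
                     phi (mul a b) = Order.meet (phi a) (phi b)).
Proof.
have SF : ultra_closed S.
  case: hS => ->; last exact: proper_lprime_ideals_ultra_closed.
  by move=> F FU; apply: lprime_ideals_ultra_closed.
have Slp : S `<=` lprime_ideals add mul by case: hS => -> // p [].
have phiE a b : avoiding S (add a b) = Order.join (avoiding S a) (avoiding S b) /\
                avoiding S (mul a b) = Order.meet (avoiding S a) (avoiding S b).
  split; apply: val_inj; rewrite ?(gen_latticeU, gen_latticeI) /=.
    apply/seteqP; split=> p; have [pA _] := Slp _ (set_valP p).
      by move=> npab; apply/not_andP => /(pA a b).
    by move/not_andP => npab /(pA a b).
  apply/seteqP; split=> p; have [_ pM] := Slp _ (set_valP p).
    by move=> npab; apply/not_orP => /(pM a b).
  by move/not_orP => npab /(pM a b).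
(* By [phiE] and primality of [q], the preimage is l-prime; properness is checked separately. *)
have phiS (q : set (gen_lattice (@pos_subbase X S))) :
    prime_ideals q -> S (avoiding S @^-1` q).
  move=> pq.
  have lp : lprime_ideals add mul (avoiding S @^-1` q).
    split=> a b /=; have [eU eI] := phiE a b; rewrite ?eU ?eI.
      exact: prime_idealU.
    exact: prime_idealI.
  (* The equality is used pointwise, since the lattice and [q] depend on [S]. *)
  case: hS => SE; have SEp p : S p = _ p := congr1 (@^~ p) SE; rewrite SEp //.
  split=> //=.
    (* Every point of [S] contains [xi0] and none contains [xi1], so their images are the empty and
       the full set. *)
    rewrite (_ : avoiding S xi0 = Order.bottom); first exact: prime_ideal0.
    apply: val_inj; apply/seteqP; split=> p //=; apply.
    by have := set_valP p; rewrite SEp => -[].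
  rewrite (_ : avoiding S xi1 = Order.top); first exact: prime_ideal1.
  apply: val_inj; apply/seteqP; split=> p //= _.
  by have := set_valP p; rewrite SEp => -[].
(* This gives uniqueness in both (iv) and (v). *)
have uniq d (L : tbDistrLatticeType d) (theta : X -> L)
    (l m : gen_lattice (@pos_subbase X S) -> L) :
    lattice_hom l -> l \o avoiding S = theta ->
    lattice_hom m -> m \o avoiding S = theta -> l = m.
  move=> lh <- mh mE.
  apply: (lattice_hom_ext (@generates_avoiding X S)) => // _ /set_mem [x _ <-].
  exact: esym (congr1 (@^~ x) mE).
exists set_display, (gen_lattice (@pos_subbase X S)), (avoiding S).
split; first exact: generates_avoiding.
split; first by exists phiS; apply: pullback_avoiding_S_isomorphism.
split=> [d' L' theta thetaS _|].
  have [l [lh lP]] := pullback_factorization thetaS.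
  have lE : l \o avoiding S = theta.
    (* Both [l (avoiding S x)] and [theta x] represent the generator at [x]. *)
    by apply/funext => x; apply: represents_inj (lP _) _; apply: represents_gen.
  by exists l; split=> // m [mh mE]; apply: uniq mE.
split=> // d1 L1 phi1 phi1S iso1.
have [l [lh lP]] := pullback_factorization phi1S.
have lE : l \o avoiding S = phi1.
  by apply/funext => x; apply: represents_inj (lP _) _; apply: represents_gen.
exists l; split; last by move=> m [[mh _] mE]; apply: uniq mE.
by split=> //; split=> //; apply: factorization_bijective iso1 lP.
Qed.
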